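(* Let $p\ge 3$ be a prime and let $a(m)=a_{1+x,p}(m)$ denote the number of accessible $m$-blocks for the polynomial $1+x$ modulo $p$. Then $a(0)=1$, $a(1)=p$, $a(2)=p^2$, and for all integers $n\ge 0$ and $0\le k\le p-1$ with $pn+k\ge 3$, $$a(pn+k)=\frac{(p-k)(p-k+1)}{2}\,a(n)+\Big(kp+k-k^2+\frac{p^2-p}{2}\Big)a(n+1)+\frac{k^2-k}{2}\,a(n+2)-(2p-1)(2p-2).$$
   Context: For a prime $p$ and a polynomial $f(x)$ with integer coefficients, ''row $i$'' is the string of coefficients of $f(x)^i$ reduced modulo $p$, ordered by increasing powers of $x$ (from $x^0$ up to $x^{\deg f^i}$). An $m$-block is a string of $m$ residues modulo $p$. An $m$-block is accessible if it occurs as a substring of consecutive entries of row $i$ for some $i\ge 0$. $a_{f,p}(m)$ is the number of accessible $m$-blocks, with the convention $a_{f,p}(0)=1$. *)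

(* Defs.v *)
From mathcomp Require Import all_boot all_order all_algebra.
From mathcomp Require Import boolp.

Set Implicit Arguments.
Unset Strict Implicit.
Unset Printing Implicit Defensive.

Import GRing.Theory.
Local Open Scope ring_scope.

(* Reduction modulo p is done entrywise on the coefficient list of f ^+ i over
   the integers, so the row extends exactly from 'X^0 to the integral degree of
   f ^+ i: it is never padded with zeros, and trailing entries that vanish
   modulo p are kept.  As always with 'F_p, p is meant to be prime. *)
Definition row_mod (f : {poly int}) (p i : nat) : seq 'F_p :=
  [seq c%:~R | c <- (f ^+ i : {poly int})].

Definition accessible (f : {poly int}) (p m : nat) (b : m.-tuple 'F_p) : Prop :=
  exists i : nat, infix b (row_mod f p i).

(* For m = 0 this is 1, since the empty block is an infix of every row. *)
Definition num_accessible (f : {poly int}) (p m : nat) : nat :=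
  #|[set b : m.-tuple 'F_p | `[< accessible f b >]]|.

(* Main.v *)
(* Padding a row of Pascal's triangle by zeros creates no new blocks, as row
   p^N + i contains row i surrounded by zeros (shifted by p^N).  Give the block
   starting at column q of row R the type (R mod p, q mod p).  By Lucas' theorem
   a block of type (r, s) is the expansion of an accessible block of length n,
   n+1 or n+2, which it determines, so the number of blocks of each type is a
   value of a, and the p^2 types yield the main terms of the formula.  The
   recurrence (q+1) C(R, q+1) = (R-q) C(R, q) shows that the type of a block
   is unique, except that the zero block has all p^2 types, while the
   nonzero blocks (0, .., 0, x), (x, 0, .., 0) and (x, -x, x, ..) have p types
   each.  The overcount is thus (p^2-1) + 3(p-1)^2 = (2p-1)(2p-2). *)
Require Import Defs.
From mathcomp Require Import all_boot all_order all_algebra.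
From mathcomp Require Import boolp zify ring.

Import GRing.Theory.
Local Open Scope ring_scope.

(** * Lucas' theorem and binomial coefficients modulo [p] *)

(** Induction on the upper number by Pascal's rule; the cases record whether lowering a number by
    one borrows from its higher digit. *)
Lemma lucas {p i j r s : nat} : prime p -> (r < p)%N -> (s < p)%N ->
  'C(p * i + r, p * j + s)%:R = ('C(i, j) * 'C(r, s))%:R :> 'F_p.
Proof.
move=> hp; have p0 := pchar_Fp_0 hp; have p_gt1 := prime_gt1 hp.
move En: (p * i + r)%N => n; elim: n i r En j s => [|n IHn] i r En j s rp sp.
  have [-> ->] : i = 0%N /\ r = 0%N by nia.
  rewrite !bin0n; congr (_%:R); case: j s {sp} => [|j] [|s] //=; by case: eqP; nia.
case: s sp => [|s] sp; last first.
  rewrite addnS binS natrD; case: r rp En => [|r] rp En.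
    case: i En => [|i] En; first by lia.
    have En' : (p * i + p.-1)%N = n by lia.
    rewrite -addnS (IHn _ _ En' j s.+1) ?(IHn _ _ En' j s); try lia.
    rewrite bin0n muln0 -natrD -mulnDr addnC.
    (* After a borrow in the upper number, the two terms combine to a multiple of ['C(p, s.+1)],
       which [p] divides. *)
    have /dvdnP[c dvd] : (p %| 'C(p, s.+1))%N by apply: prime_dvd_bin => //; lia.
    have -> : ('C(p.-1, s) + 'C(p.-1, s.+1) = c * p)%N.
      by rewrite -dvd -{3}(prednK (prime_gt0 hp)) binS addnC.
    by rewrite mulnA natrM p0 mulr0.
  have En' : (p * i + r)%N = n by lia.
  rewrite -addnS (IHn _ _ En' j s.+1) ?(IHn _ _ En' j s); try lia.
  by rewrite -natrD -mulnDr binS.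
rewrite addn0 !bin0 muln1; case: j => [|j]; first by rewrite muln0 !bin0.
have -> : (p * j.+1)%N = (p * j + p.-1).+1 by lia.
rewrite binS.
have -> : (p * j + p.-1).+1 = (p * j.+1 + 0)%N by lia.
rewrite natrD; case: r rp En => [|r] rp En.
  case: i En => [|i] En; first by lia.
  have En' : (p * i + p.-1)%N = n by lia.
  rewrite (IHn _ _ En' j.+1 0%N) ?(IHn _ _ En' j p.-1); try lia.
  by rewrite bin0 binn !muln1 -natrD binS.
have En' : (p * i + r)%N = n by lia.
rewrite (IHn _ _ En' j.+1 0%N) ?(IHn _ _ En' j p.-1); try lia.
(* Here [r < p.-1], so the term with a borrow in the lower number vanishes. *)
by rewrite (@bin_small r p.-1) ?bin0 ?muln0 ?muln1 ?addr0 //; lia.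
Qed.

Lemma lucas_expn {p N i j r s : nat} : prime p ->
  (r < p ^ N)%N -> (s < p ^ N)%N ->
  'C(p ^ N * i + r, p ^ N * j + s)%:R = ('C(i, j) * 'C(r, s))%:R :> 'F_p.
Proof.
move=> hp; have p_gt0 := prime_gt0 hp.
elim: N i j r s => [|N IHN] i j r s rN sN.
  by have [-> ->] : r = 0%N /\ s = 0%N; [lia | rewrite !mul1n !addn0 bin0 muln1].
have digits t u : (p ^ N.+1 * t + u)%N = (p * (p ^ N * t + u %/ p) + u %% p)%N.
  by rewrite {1}(divn_eq u p) expnS; lia.
have qN u : (u < p ^ N.+1)%N -> (u %/ p < p ^ N)%N.
  by move=> uN; rewrite ltn_divLR // mulnC -expnS.
rewrite (digits i r) (digits j s) lucas ?ltn_mod // natrM (IHN _ _ _ _ (qN _ rN) (qN _ sN)).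
rewrite {3}(divn_eq r p) {3}(divn_eq s p) ![(_ %/ p * p)%N]mulnC natrM natrM lucas ?ltn_mod //.
by rewrite natrM mulrA.
Qed.

Lemma natFp_eq {p m n : nat} : prime p ->
  (m%:R == n%:R :> 'F_p) = (m == n %[mod p])%N.
Proof. by move=> hp; rewrite -val_eqE /= !val_Fp_nat. Qed.

Lemma natFp_val {p : nat} (x : 'F_p) : (x : nat)%:R = x :> 'F_p.
Proof. exact: natr_Zp. Qed.

Lemma ltn_Fp {p : nat} (x : 'F_p) : prime p -> (x < p)%N.
Proof. by move=> hp; rewrite -{2}(Fp_cast hp) ltn_ord. Qed.

Lemma bin_Fp_neq0 {p r s : nat} : prime p -> (s <= r < p)%N ->
  'C(r, s)%:R != 0 :> 'F_p.
Proof.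
move=> hp /andP[sr rp]; rewrite -[X in _ != X]/(0%:R) natFp_eq // mod0n -/(dvdn p 'C(r, s)).
apply/negP => pdvd; have : (p %| r`!)%N by rewrite -(bin_fact sr) dvdn_mulr.
move: rp; elim: (r) => [|u IHu] up; first by rewrite fact0 dvdn1; case: eqP hp => // ->.
by rewrite factS Euclid_dvdM // gtnNdvd //=; apply: IHu; lia.
Qed.

(** Replacing truncated subtraction by that of ['F_p] is harmless: for [R < q] both sides vanish. *)
Lemma bin_Fp_rec {p R q : nat} :
  q.+1%:R * 'C(R, q.+1)%:R = (R%:R - q%:R) * 'C(R, q)%:R :> 'F_p.
Proof.
rewrite -natrM mul_bin_left natrM; have [qR|Rq] := leqP q R.
  by rewrite natrB.
by rewrite bin_small // !mulr0.
Qed.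

(** For [q.+1 < p ^ N], ['C(p ^ N, q.+1)] vanishes modulo [p], so neighbours in the preceding row
    are opposite. *)
Lemma bin_pred_expn {p N q : nat} : prime p -> (q < p ^ N)%N ->
  'C((p ^ N).-1, q)%:R = (-1) ^+ q :> 'F_p.
Proof.
move=> hp; have pN0 : (0 < p ^ N)%N by rewrite expn_gt0 prime_gt0.
elim: q => [|q IHq] qN; first by rewrite bin0.
have : 'C((p ^ N * 1 + 0), (p ^ N * 0 + q.+1))%:R = 0 :> 'F_p.
  by rewrite lucas_expn // bin0n muln0.
rewrite muln1 muln0 addn0 add0n -{1}(prednK pN0) binS natrD IHq; last by lia.
by move/eqP; rewrite addr_eq0 exprS mulN1r => /eqP ->.
Qed.

(** * Blocks as windows of Pascal's triangle *)

Definition block {K : Type} (m : nat) (f : nat -> K) : m.-tuple K :=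
  [tuple f i | i < m].

Lemma eq_block {K : eqType} {m : nat} {f g : nat -> K} :
  (forall t, (t < m)%N -> f t = g t) <-> block m f = block m g.
Proof.
split=> [fg|fg t tm]; first by apply: eq_from_tnth => i; rewrite !tnth_mktuple fg.
by have := congr1 (fun b => tnth b (Ordinal tm)) fg; rewrite !tnth_mktuple.
Qed.

Lemma block_nth {K : Type} {m : nat} (x0 : K) (b : m.-tuple K) : block m (nth x0 b) = b.
Proof. by apply: eq_from_tnth => i; rewrite tnth_mktuple -tnth_nth. Qed.

Lemma nth_block {K : Type} {m t : nat} (x0 : K) (f : nat -> K) : (t < m)%N ->
  nth x0 (block m f) t = f t.
Proof. by move=> tm; rewrite -[t]/(val (Ordinal tm)) nth_mktuple. Qed.

(** The window may run past the end of its row, where binomials are zero; this realizes the padding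
    by zeros. *)
Definition pascal (p m R q : nat) : m.-tuple 'F_p :=
  block m (fun t => 'C(R, q + t)%:R).

Lemma pascal_eq {p m R R' q q' : nat} :
  (forall t, (t < m)%N -> 'C(R, q + t)%:R = 'C(R', q' + t)%:R :> 'F_p) ->
  pascal p m R q = pascal p m R' q'.
Proof. by move=> h; apply/eq_block. Qed.

Lemma coef_exp_1X (R : nat) (q : nat) : ((1 + 'X : {poly int}) ^+ R)`_q = 'C(R, q)%:R.
Proof.
elim: R q => [|R IHR] q; first by rewrite expr0 coef1 bin0n.
rewrite exprS mulrDl mul1r coefD coefXM !IHR.
case: q => [|q] /=; first by rewrite !bin0 addr0.
by rewrite binS natrD.
Qed.

Lemma size_exp_1X (R : nat) : size ((1 + 'X : {poly int}) ^+ R) = R.+1.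
Proof. by rewrite addrC -[1]opprK -polyC1 -polyCN size_exp_XsubC. Qed.

Lemma nth_row (p R q : nat) : (row_mod (1 + 'X) p R)`_q = 'C(R, q)%:R.
Proof.
rewrite /row_mod; have [qR|Rq] := ltnP q R.+1.
  by rewrite (nth_map 0) ?size_exp_1X // coef_exp_1X rmorph_nat.
by rewrite nth_default ?size_map ?size_exp_1X // bin_small.
Qed.

Lemma size_row (p R : nat) : size (row_mod (1 + 'X) p R) = R.+1.
Proof. by rewrite size_map size_exp_1X. Qed.

Lemma accessibleP {p m : nat} {b : m.-tuple 'F_p} : prime p ->
  accessible (1 + 'X) b <-> exists R q, b = pascal p m R q.
Proof.
move=> hp; split=> [[R /infixP[s [s' e]]]|[R [q ->]]].
  exists R, (size s); rewrite -[b in LHS](block_nth 0); apply/eq_block => t tm.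
  by rewrite -nth_row e nth_cat ltnNge leq_addr /= addKn nth_cat size_tuple tm.
have [N hN] : exists N, (R + q + m < p ^ N)%N.
  by exists (R + q + m)%N; apply/ltn_expl/prime_gt1.
(* Below column [p ^ N] this row agrees with row [R], and it is long enough to contain the whole
   window. *)
exists (p ^ N * 1 + R)%N; apply/infixP.
set w := row_mod _ _ _; exists (take q w), (drop (q + m) w).
rewrite -{1}(cat_take_drop q w); congr (_ ++ _).
rewrite -{1}(cat_take_drop m (drop q w)) drop_drop addnC; congr (_ ++ _).
have sw : size w = (p ^ N * 1 + R).+1 by rewrite /w size_row.
apply: (@eq_from_nth _ 0).
  by rewrite size_takel ?size_tuple // size_drop sw; lia.
move=> t; rewrite size_takel ?size_drop ?sw; last by lia.
move=> tm; rewrite nth_take // nth_drop nth_block // /w nth_row.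
have := @lucas_expn p N 1 0 R (q + t) hp; rewrite muln0 add0n bin0 mul1n; apply; lia.
Qed.

(** Translating row and column by [p ^ N] keeps the window; [expand_pascal] asks for a positive
    column when [r < s]. *)
Lemma pascal_shift {p : nat} (m R q : nat) : prime p ->
  exists R' q', (0 < q')%N /\ pascal p m R q = pascal p m R' q'.
Proof.
move=> hp; have [N hN] : exists N, (R + q + m < p ^ N)%N.
  by exists (R + q + m)%N; apply/ltn_expl/prime_gt1.
exists (p ^ N * 1 + R)%N, (p ^ N * 1 + q)%N; split; first by lia.
by apply: pascal_eq => t tm; rewrite -addnA lucas_expn ?binn ?mul1n //; lia.
Qed.

(** * Types of blocks and expansion by Lucas' theorem *)

Definition typed {p m : nat} (rs : 'F_p * 'F_p) (b : m.-tuple 'F_p) : Prop :=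
  exists R q : nat, [/\ b = pascal p m R q, R%:R = rs.1 & q%:R = rs.2].

(* A cell is a maximal run of columns pj, .., pj+p-1.  When r < s, the entries
   of a block of type (r, s) in its first cell vanish, so that cell is dropped. *)
Definition num_cells (p m r s : nat) : nat := ((s + m + p.-1) %/ p - (r < s))%N.

(** The Lucas product: the quotient selects an entry of [v], the remainder a column of row [r]. For
    [r < s], truncated subtraction sends the dropped cell to index 0, but its binomials vanish. *)
Definition expand (p m r s : nat) (v : seq 'F_p) : m.-tuple 'F_p :=
  block m (fun t => v`_((s + t) %/ p - (r < s)) * 'C(r, (s + t) %% p)%:R).

Lemma expand_pascal {p m r s R q : nat} : prime p -> (r < p)%N -> (s < p)%N ->
  ((r < s)%N <= q)%N ->
  expand p m r s (pascal p (num_cells p m r s) R q) =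
  pascal p m (p * R + r) (p * (q - (r < s)%N) + s).
Proof.
move=> hp rp sp eq; have p_gt0 := prime_gt0 hp; apply/eq_block => t tm.
rewrite -addnA {3}(divn_eq (s + t) p) [(_ %/ p * p)%N]mulnC addnA -mulnDr.
rewrite lucas ?ltn_mod // natrM.
have [ec|ce] := leqP (r < s)%N ((s + t) %/ p).
  rewrite nth_block; first by congr (_ * _); congr ('C(_, _)%:R); lia.
  have cD : ((s + t) %/ p < (s + m + p.-1) %/ p)%N.
    rewrite leq_divRL // mulSn; have := leq_divM (s + t) p; lia.
  by rewrite /num_cells ltn_sub2r // (leq_ltn_trans ec).
(* The entry lies in the dropped cell; both sides vanish because its offset [s + t] exceeds [r]. *)
have c0 : ((s + t) %/ p = 0)%N by move: ce; case: (r < s)%N; case: (_ %/ _)%N.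
have rs : (r < s)%N by case: (r < s)%N ce.
have stp : (s + t < p)%N by rewrite -[p]mul1n -ltn_divLR // c0.
by rewrite modn_small // (bin_small (n := r)) ?mulr0 //; lia.
Qed.

(** Every kept cell meets the block in a column of offset at most [r]; there the factor ['C(r, _)]
    is invertible, so the entry of [v] can be read off. *)
Lemma expand_inj {p m r s : nat} : prime p -> (r < p)%N -> (s < p)%N -> (0 < m)%N ->
  injective (fun v : (num_cells p m r s).-tuple 'F_p => expand p m r s v).
Proof.
move=> hp rp sp m_gt0 v w /eq_block vw; have p_gt0 := prime_gt0 hp.
rewrite -(block_nth 0 v) -(block_nth 0 w); apply/eq_block => u; rewrite /num_cells => uL.
have [t [tm tu tr]] : exists t, [/\ (t < m)%N,
    ((s + t) %/ p - (r < s) = u)%N & ((s + t) %% p <= r)%N].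
  (* The witness is the first column of the cell, except for a kept cell 0, which the block enters
     at offset [s <= r]. *)
  have [c0|c_gt0] := posnP (u + (r < s))%N.
    exists 0%N; rewrite addn0 modn_small // divn_small //.
    by split=> //; move: c0; case: ltnP => //; lia.
  have sc : (p <= p * (u + (r < s)))%N by rewrite leq_pmulr.
  exists (p * (u + (r < s)) - s)%N; rewrite subnKC; last by lia.
  rewrite mulKn // modnMr; split=> //; last by lia.
  have : (p * (u + (r < s)).+1 <= s + m + p.-1)%N.
    by rewrite mulnC -leq_divRL //; lia.
  by rewrite mulnS; lia.
have := vw t tm; rewrite tu; apply: mulIf.
by apply: bin_Fp_neq0; rewrite ?tr.
Qed.

(** [expand] is injective, and dividing row and column by [p] shows that it reaches every block of
    the type. *)
Lemma card_typed {p m : nat} (rs : 'F_p * 'F_p) : prime p -> (0 < m)%N ->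
  #|[set b : m.-tuple 'F_p | `[< typed rs b >]]| =
  num_accessible (1 + 'X) p (num_cells p m rs.1 rs.2).
Proof.
case: rs => r s hp m_gt0 /=; have [rp sp] := (ltn_Fp r hp, ltn_Fp s hp).
rewrite /num_accessible -(card_imset _ (expand_inj hp rp sp m_gt0)); apply: eq_card => b.
rewrite inE; apply/asboolP/imsetP => [[R [q [-> /= Rr qs]]]|[v]].
  exists (pascal p _ (R %/ p) (q %/ p + (r < s)%N)).
    by rewrite inE; apply/asboolP/accessibleP => //; exists (R %/ p)%N, (q %/ p + (r < s)%N)%N.
  rewrite expand_pascal ?leq_addl // addnK -Rr -qs !val_Fp_nat //.
  by rewrite ![(p * _)%N]mulnC -!divn_eq.
rewrite inE => /asboolP/accessibleP[] // R [q ->] ->.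
have [R' [q' [q'_gt0 ->]]] := pascal_shift (num_cells p m r s) R q hp.
rewrite expand_pascal //; last by case: (_ < _)%N.
do 2 eexists; split; first reflexivity.
  by rewrite natrD natrM pchar_Fp_0 // mul0r add0r natFp_val.
by rewrite natrD natrM pchar_Fp_0 // mul0r add0r natFp_val.
Qed.

Lemma typed_accessible {p m : nat} (b : m.-tuple 'F_p) : prime p ->
  accessible (1 + 'X) b <-> exists rs, typed rs b.
Proof.
move=> hp; rewrite (accessibleP hp); split=> [[R [q ->]]|[rs [R [q [-> _ _]]]]].
  by exists (R%:R, q%:R), R, q.
by exists R, q.
Qed.

(** * Blocks with several types *)

(** The coefficients depend on the type alone, so a known block constrains its types. *)
Lemma typed_rec {p m : nat} {rs : 'F_p * 'F_p} {b : m.-tuple 'F_p} {t : nat} :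
  typed rs b -> (t.+1 < m)%N ->
  (rs.2 + t.+1%:R) * b`_t.+1 = (rs.1 - (rs.2 + t%:R)) * b`_t.
Proof.
move=> [R [q [-> <- <-]]] tm; rewrite !nth_block //; last by lia.
by rewrite -!natrD addnS bin_Fp_rec.
Qed.

Definition last_block {K : zmodType} (m : nat) (x : K) : m.-tuple K :=
  block m (fun t => if t.+1 == m then x else 0).
Definition first_block {K : zmodType} (m : nat) (x : K) : m.-tuple K :=
  block m (fun t => if t == 0%N then x else 0).
Definition alt_block {K : nzRingType} (m : nat) (x : K) : m.-tuple K :=
  block m (fun t => x * (-1) ^+ t).
Definition zero_block {K : zmodType} (m : nat) : m.-tuple K := block m (fun=> 0).

Lemma expn_exceeds {p : nat} (B : nat) : prime p ->
  exists N, (B < p ^ N)%N /\ (p ^ N)%:R = 0 :> 'F_p.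
Proof.
move=> hp; exists B.+1; rewrite natrX pchar_Fp_0 // expr0n; split=> //.
exact: ltnW (ltn_expl _ (prime_gt1 hp)).
Qed.

Lemma typed_zero {p m : nat} (rs : 'F_p * 'F_p) : prime p -> typed rs (zero_block m).
Proof.
(* Row [rs.1] ends before column [p]. *)
move=> hp; exists rs.1, (p + rs.2)%N; rewrite natrD pchar_Fp_0 // add0r !natFp_val.
by split=> //; apply/eq_block => t _; rewrite bin_small //; have := ltn_Fp rs.1 hp; lia.
Qed.

Lemma typed_last {p m : nat} (r x : 'F_p) : prime p -> (0 < m)%N ->
  typed (r, - m.-1%:R) (last_block m x).
Proof.
move=> hp m_gt0; have [N [hN pN0]] := expn_exceeds (m + p) hp; have rp := ltn_Fp r hp.
(* The window ends at column [p ^ N], whose entry is ['C(x, 1)], and the columns before it hold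
   zeros. *)
exists (p ^ N * x + r)%N, (p ^ N - m.-1)%N.
rewrite natrD natrM pN0 mul0r add0r natFp_val natrB; last by lia.
rewrite pN0 add0r; split=> //; apply/eq_block => t tm.
have [tm'|tm'] := eqVneq t.+1 m.
  have -> : (p ^ N - m.-1 + t = p ^ N * 1 + 0)%N by lia.
  by rewrite lucas_expn ?bin1 ?bin0 ?muln1 ?natFp_val //; lia.
have -> : (p ^ N - m.-1 + t = p ^ N * 0 + (p ^ N - m.-1 + t))%N by lia.
by rewrite lucas_expn ?(bin_small (n := r)) ?muln0 //; lia.
Qed.

Lemma typed_first {p m : nat} (r x : 'F_p) : prime p -> typed (r, r) (first_block m x).
Proof.
move=> hp; have [N [hN pN0]] := expn_exceeds (m + p) hp; have rp := ltn_Fp r hp.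
(* The window starts at the last nonzero factor ['C(r, r)], multiplied by ['C(x, 1)]. *)
exists (p ^ N * x + r)%N, (p ^ N * 1 + r)%N.
rewrite !natrD !natrM pN0 !mul0r add0r natFp_val; split=> //; apply/eq_block => t tm.
rewrite -addnA lucas_expn ?bin1 //; try by lia.
by case: t tm => [|t] tm; rewrite ?addn0 ?binn ?muln1 ?natFp_val ?bin_small ?muln0 //; lia.
Qed.

Lemma typed_alt {p m : nat} (s x : 'F_p) : prime p -> typed (-1, s) (alt_block m x).
Proof.
move=> hp; have [N [hN pN0]] := expn_exceeds (m + p) hp; have sp := ltn_Fp s hp.
(* The factor cancels the sign [(-1) ^+ s] with which row [(p ^ N).-1] enters at column [s]. *)
have [y ey] : exists y : 'F_p, y = x * (-1) ^+ s by eexists.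
exists (p ^ N * y + (p ^ N).-1)%N, (p ^ N * 1 + s)%N; split=> /=.
- apply/eq_block => t tm; rewrite -addnA lucas_expn ?bin1 //; try by lia.
  rewrite natrM natFp_val ey bin_pred_expn //; last by lia.
  by rewrite exprD mulrA -(mulrA x) -exprMn mulrNN mul1r expr1n mulr1.
- by rewrite natrD natrM pN0 mul0r add0r -subn1 natrB ?pN0 ?sub0r //; lia.
- by rewrite natrD natrM pN0 mul0r add0r natFp_val.
Qed.

(** * The number of types of a block *)

Definition types {p m : nat} (b : m.-tuple 'F_p) : {set 'F_p * 'F_p} :=
  [set rs | `[< typed rs b >]].

Lemma types_zero {p m : nat} : prime p -> #|types (zero_block m : m.-tuple 'F_p)| = (p ^ 2)%N.
Proof.
move=> hp; rewrite -[p in RHS](card_Fp hp) -mulnn -card_prod -cardsT; apply: eq_card => rs.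
by rewrite !inE; apply/asboolP/typed_zero.
Qed.

(** The recurrence between the last two entries fixes the column residue and leaves the row residue
    free. *)
Lemma types_last {p m : nat} (x : 'F_p) : prime p -> (2 <= m)%N -> x != 0 ->
  #|types (last_block m x)| = p.
Proof.
case: m => [|[|m]] // hp _ x0; rewrite -[RHS](card_Fp hp) -cardsT.
have inj : injective (fun r : 'F_p => (r, - m.+1%:R : 'F_p)) by move=> r r' [].
rewrite -(card_imset _ inj); apply: eq_card => -[r s].
rewrite inE; apply/asboolP/imsetP => [ht|[r' _ ->]]; last by exact: typed_last.
have := typed_rec ht (leqnn m.+2); rewrite !nth_block // eqxx (ltn_eqF (leqnn m.+2)) mulr0.
by move/eqP; rewrite mulf_eq0 (negPf x0) orbF addr_eq0 => /eqP /= ->; exists r.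
Qed.

(** The recurrence between the first two entries, [x] and [0], forces [r = s]. *)
Lemma types_first {p m : nat} (x : 'F_p) : prime p -> (2 <= m)%N -> x != 0 ->
  #|types (first_block m x)| = p.
Proof.
move=> hp m2 x0; rewrite -[RHS](card_Fp hp) -cardsT.
have inj : injective (fun r : 'F_p => (r, r)) by move=> r r' [].
rewrite -(card_imset _ inj); apply: eq_card => -[r s].
rewrite inE; apply/asboolP/imsetP => [ht|[r' _ ->]]; last exact: typed_first.
have := typed_rec ht m2; rewrite !nth_block //=; last by lia.
move/esym/eqP; rewrite mulr0 mulf_eq0 (negPf x0) orbF addr0 subr_eq0 => /eqP ->.
by exists s.
Qed.

(** The recurrence between the first two entries, [x] and [- x], forces [r = -1]. *)
Lemma types_alt {p m : nat} (x : 'F_p) : prime p -> (2 <= m)%N -> x != 0 ->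
  #|types (alt_block m x)| = p.
Proof.
move=> hp m2 x0; rewrite -[RHS](card_Fp hp) -cardsT.
have inj : injective (fun s : 'F_p => (-1 : 'F_p, s)) by move=> r r' [].
rewrite -(card_imset _ inj); apply: eq_card => -[r s].
rewrite inE; apply/asboolP/imsetP => [ht|[r' _ ->]]; last exact: typed_alt.
have := typed_rec ht m2; rewrite !nth_block //=; last by lia.
rewrite expr1 expr0 => e; have rs : - (s + 1) = r - s.
  by apply: (mulIf x0); transitivity ((r - (s + 0)) * (x * 1)); [rewrite -e; ring | ring].
exists s => //; congr (_, _).
by rewrite -[r](subrK s) -rs; ring.
Qed.

(* Subtracting the recurrences of two types makes the block geometric up to its
   last entry; three entries of a nonzero geometric block force the ratio -1. *)
Lemma typed_uniq {p m : nat} {rs rs' : 'F_p * 'F_p} {b : m.-tuple 'F_p} : (3 <= m)%N ->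
  typed rs b -> typed rs' b -> rs != rs' ->
  exists x, [\/ b = last_block m x, b = first_block m x | b = alt_block m x].
Proof.
case: rs rs' => r s [r' s'] m3 ht ht'.
have hd t : (t.+1 < m)%N -> (s - s') * (b`_t.+1 + b`_t) = (r - r') * b`_t.
  move=> tm; have /= e := typed_rec ht tm; have /= e' := typed_rec ht' tm.
  have -> : (s - s') * (b`_t.+1 + b`_t) = (s + t.+1%:R) * b`_t.+1
    - (s' + t.+1%:R) * b`_t.+1 + (s - s') * b`_t by ring.
  by rewrite e e'; ring.
(* With equal column residues, the difference kills every entry but the last. *)
have [ss'|ss'] := eqVneq s s'; rewrite xpair_eqE.
  rewrite ss' eqxx andbT => rr'.
  exists b`_m.-1; apply: Or31; rewrite -[b in LHS](block_nth 0); apply/eq_block => t tm.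
  have [tm'|tm'] := eqVneq t.+1 m; first by congr (b`_ _); lia.
  have /hd/esym/eqP : (t.+1 < m)%N by lia.
  by rewrite ss' subrr mul0r mulf_eq0 subr_eq0 (negPf rr') => /eqP.
move=> _; exists b`_0; pose c := (r - r') / (s - s') - 1.
have bS t : (t.+1 < m)%N -> b`_t.+1 = c * b`_t.
  move=> /hd e; have ss0 : s - s' != 0 by rewrite subr_eq0.
  apply: (mulfI ss0); rewrite -[LHS](addrK ((s - s') * b`_t)) -mulrDr e.
  by rewrite /c [RHS]mulrA mulrBr mulr1 mulrCA mulfV // mulr1 -mulrBl.
have geo t : (t < m)%N -> b`_t = b`_0 * c ^+ t.
  elim: t => [|t IHt] tm; first by rewrite expr0 mulr1.
  by rewrite (bS t tm) (IHt (ltnW tm)) exprS mulrCA.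
(* If the first entry or the ratio is zero, all later entries vanish. *)
have [bc0|] := eqVneq (b`_0 * c) 0.
  apply: Or32; rewrite -[b in LHS](block_nth 0); apply/eq_block => -[|t] // tm.
  by rewrite (geo _ tm) exprS mulrA bc0 mul0r.
rewrite mulf_eq0 negb_or => /andP[b0 c0]; apply: Or33.
suff -> : alt_block m b`_0 = block m (fun t => b`_0 * c ^+ t).
  by rewrite -[b in LHS](block_nth 0); apply/eq_block.
suff -> : c = -1 by [].
have /= e0 := typed_rec ht (ltnW m3); have /= e1 := typed_rec ht m3.
move: e0 e1; rewrite !bS ?(ltnW m3) // => e0 e1.
have {}e0 : (s + 1) * c = r - s.
  by apply: (mulIf b0); rewrite -mulrA e0 addr0.
have {}e1 : (s + 2%:R) * c = r - (s + 1).
  by apply: (mulIf (mulf_neq0 c0 b0)); rewrite -mulrA e1.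
(* The recurrences at positions 0 and 1 evaluate these products as [r - (s + 1)] and [r - s]. *)
have -> : c = (s + 2%:R) * c - (s + 1) * c by ring.
by rewrite e0 e1; ring.
Qed.

(** The scalar 0 is left out because it gives the zero block in each of the three families. *)
Definition punctured {K : finNzRingType} {m : nat} (F : K -> m.-tuple K) : {set m.-tuple K} :=
  [set F x | x in [set~ 0]].

Lemma card_punctured {p m : nat} {F : 'F_p -> m.-tuple 'F_p} (t : nat) : prime p ->
  (forall x, (F x)`_t = x) -> #|punctured F| = p.-1.
Proof.
move=> hp Ft; rewrite card_in_imset; first by rewrite cardsC1 card_Fp.
by move=> x y _ _ /(congr1 (fun b : m.-tuple _ => b`_t)); rewrite !Ft.
Qed.

(** One type per accessible block plus the excess of the exceptional ones, as a sum of indicators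
    ready to be summed over all blocks. *)
Lemma card_types {p m : nat} (b : m.-tuple 'F_p) : prime p -> (3 <= m)%N ->
  #|types b| = (`[< accessible (1 + 'X) b >] + (b == zero_block m) * (p ^ 2).-1
    + ((b \in punctured (last_block m)) + (b \in punctured (first_block m))
       + (b \in punctured (alt_block m))) * p.-1)%N.
Proof.
move=> hp m3; have p_gt0 := prime_gt0 hp.
have [m0 m1 mm] : [/\ (0 < m)%N, (1 < m)%N & (m.-1 < m)%N] by split; lia.
(* Positions 0, 1 and [m.-1] tell the families apart; [3 <= m] keeps the last one away from 0 and
   1. *)
have lastE x : [/\ (last_block m x)`_0 = 0 :> 'F_p, (last_block m x)`_1 = 0 &
    (last_block m x)`_m.-1 = x].
  have [n1 n2] : (1%N == m) = false /\ (2%N == m) = false by split; lia.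
  by rewrite !nth_block // prednK // n1 n2 eqxx.
have firstE x : (first_block m x)`_0 = x :> 'F_p /\ (first_block m x)`_1 = 0.
  by rewrite !nth_block.
have altE x : (alt_block m x)`_0 = x :> 'F_p /\ (alt_block m x)`_1 = - x.
  by rewrite !nth_block // mulr1 mulrN1.
have zeroE t : (t < m)%N -> (zero_block m)`_t = 0 :> 'F_p by move=> tm; rewrite nth_block.
have [->|bz] := eqVneq b (zero_block m).
  rewrite types_zero // asboolT; last first.
    by apply/typed_accessible => //; exists (0, 0); apply: typed_zero.
  have -> : (zero_block m \in punctured (last_block m : 'F_p -> _)) = false.
    apply/imsetP => -[x]; rewrite !inE => /eqP x0 e; apply: x0.
    by case: (lastE x) => _ _; rewrite -e zeroE.
  have -> : (zero_block m \in punctured (first_block m : 'F_p -> _)) = false.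
    apply/imsetP => -[x]; rewrite !inE => /eqP x0 e; apply: x0.
    by case: (firstE x) => <- _; rewrite -e zeroE.
  have -> : (zero_block m \in punctured (alt_block m : 'F_p -> _)) = false.
    apply/imsetP => -[x]; rewrite !inE => /eqP x0 e; apply: x0.
    by case: (altE x) => <- _; rewrite -e zeroE.
  by rewrite mul0n addn0 mul1n add1n prednK // expn_gt0 p_gt0.
rewrite mul0n addn0.
have [/imsetP[x]|nl] := boolP (b \in punctured (last_block m)).
  rewrite !inE => x0 ->; rewrite types_last // asboolT; last first.
    by apply/typed_accessible => //; exists (0, - m.-1%:R); apply: typed_last.
  have -> : (last_block m x \in punctured (first_block m)) = false.
    apply/imsetP => -[y]; rewrite !inE => /eqP y0 e; apply: y0.
    by case: (firstE y) => <- _; rewrite -e; case: (lastE x).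
  have -> : (last_block m x \in punctured (alt_block m)) = false.
    apply/imsetP => -[y]; rewrite !inE => /eqP y0 e; apply: y0.
    by case: (altE y) => <- _; rewrite -e; case: (lastE x).
  by rewrite /= mul1n add1n prednK.
have [/imsetP[x]|nf] := boolP (b \in punctured (first_block m)).
  rewrite !inE => x0 ->; rewrite types_first // asboolT; last first.
    by apply/typed_accessible => //; exists (0, 0); apply: typed_first.
  have -> : (first_block m x \in punctured (alt_block m)) = false.
    apply/imsetP => -[y]; rewrite !inE => /eqP y0 e; apply: y0; apply/eqP.
    by rewrite -oppr_eq0; case: (altE y) => _ <-; rewrite -e; case: (firstE x) => _ ->.
  by rewrite /= mul1n add1n prednK.
have [/imsetP[x]|na] := boolP (b \in punctured (alt_block m)).
  rewrite !inE => x0 ->; rewrite types_alt // asboolT; last first.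
    by apply/typed_accessible => //; exists (-1, 0); apply: typed_alt.
  by rewrite /= mul1n add1n prednK.
rewrite /= mul0n addn0; case: asboolP => hb.
  have [rs hrs] := (typed_accessible b hp).1 hb.
  apply/eqP/cards1P; exists rs; apply/setP => rs'; rewrite !inE.
  apply/asboolP/eqP => [hrs'|-> //]; apply/eqP/negPn/negP => ne.
  have [x bx] := typed_uniq m3 hrs' hrs ne.
  have [x0|x0] := eqVneq x 0.
    case/negP: bz; apply/eqP; case: bx => ->; apply/eq_block => t _; rewrite x0 ?if_same //.
    by rewrite mul0r.
  have xs : x \in [set~ 0] by rewrite !inE.
  by case: bx => e; [case/negP: nl | case/negP: nf | case/negP: na]; rewrite e imset_f.
apply/eqP; rewrite cards_eq0; apply/eqP/setP => rs; rewrite !inE.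
by apply/asboolP => hrs; apply: hb; apply/typed_accessible => //; exists rs.
Qed.

(** * Double counting of blocks and types *)

Lemma sum_mem_card {T : finType} (A : {set T}) : (\sum_x (x \in A : nat) = #|A|)%N.
Proof. by rewrite -sum1_card [RHS]big_mkcond; apply: eq_bigr => x _; case: (x \in A). Qed.

(** Pairs of a block and one of its types are counted by type with [card_typed] and by block with
    [card_types]. *)
Lemma sum_num_cells {p m : nat} : prime p -> (3 <= m)%N ->
  (\sum_(rs : 'F_p * 'F_p) num_accessible (1 + 'X) p (num_cells p m rs.1 rs.2) =
   num_accessible (1 + 'X) p m + (p ^ 2).-1 + 3 * p.-1 ^ 2)%N.
Proof.
move=> hp m3; have m_gt0 : (0 < m)%N by lia.
transitivity (\sum_(b : m.-tuple 'F_p) #|types b|)%N.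
  under eq_bigr => rs _ do rewrite -(card_typed rs hp m_gt0) -sum_mem_card.
  rewrite exchange_big; apply: eq_bigr => b _ /=; rewrite -sum_mem_card.
  by apply: eq_bigr => rs _; rewrite !inE.
under eq_bigr => b _ do rewrite card_types //.
rewrite !big_split /= -!big_distrl /= !big_split /= !sum_mem_card.
have zE : (\sum_(b : m.-tuple 'F_p) (b == zero_block m : nat) = 1)%N.
  rewrite (eq_bigr (fun b => (b \in [set zero_block m]) : nat)) ?sum_mem_card ?cards1 //.
  by move=> b; rewrite inE.
have aE : (\sum_(b : m.-tuple 'F_p) (`[< accessible (1 + 'X) b >] : nat) =
    num_accessible (1 + 'X) p m)%N.
  by rewrite /num_accessible -sum_mem_card; apply: eq_bigr => b _; rewrite inE.
have lE : #|punctured (@last_block 'F_p m)| = p.-1.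
  by apply: (card_punctured m.-1) => // x; rewrite nth_block ?prednK ?eqxx.
have fE : #|punctured (@first_block 'F_p m)| = p.-1.
  by apply: (card_punctured 0) => // x; rewrite nth_block.
have altE : #|punctured (@alt_block 'F_p m)| = p.-1.
  by apply: (card_punctured 0) => // x; rewrite nth_block // mulr1.
by rewrite zE aE lE fE altE; lia.
Qed.

(** * Block lengths 0, 1 and 2 *)

Lemma num_accessible0 {p : nat} : prime p -> num_accessible (1 + 'X) p 0 = 1%N.
Proof.
move=> hp; apply/eqP/cards1P; exists [tuple]; apply/setP => b; rewrite !inE tuple0 eqxx.
by apply/asboolP/accessibleP => //; exists 0%N, 0%N; rewrite [RHS]tuple0.
Qed.

Lemma accessible2 {p : nat} (b : 2.-tuple 'F_p) : prime p -> accessible (1 + 'X) b.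
Proof.
move=> hp; have p_gt1 := prime_gt1 hp; apply/accessibleP => //.
rewrite -(block_nth 0 b); pose x : 'F_p := b`_0; pose y : 'F_p := b`_1.
have [b0|b0] := eqVneq x 0.
  (* Columns [p.-1] and [p] of row [p * y] hold [0] and [y]. *)
  exists (p * y + 0)%N, (p * 0 + p.-1)%N; apply/eq_block => -[|[|t]] // _.
    by rewrite -addnA lucas ?(bin_small (n := 0)) ?muln0 //; lia.
  have -> : (p * 0 + p.-1 + 1 = p * 1 + 0)%N by lia.
  by rewrite lucas ?bin1 ?bin0 ?muln1 ?natFp_val //; lia.
pose r : 'F_p := y / x; have rp := ltn_Fp r hp.
(* Columns [p] and [p.+1] hold [x] and [x * r], which is [y]. *)
exists (p * x + r)%N, (p * 1 + 0)%N; apply/eq_block => -[|[|t]] // _.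
  by rewrite -addnA lucas ?bin1 ?bin0 ?muln1 ?natFp_val //; lia.
by rewrite -addnA lucas // add0n !bin1 natrM !natFp_val mulrC divfK.
Qed.

Lemma num_accessible2 {p : nat} : prime p -> num_accessible (1 + 'X) p 2 = (p ^ 2)%N.
Proof.
move=> hp; rewrite -[p in RHS](card_Fp hp) -card_tuple -cardsT; apply: eq_card => b.
by rewrite !inE; apply/asboolP/accessible2.
Qed.

Lemma num_accessible1 {p : nat} : prime p -> num_accessible (1 + 'X) p 1 = p.
Proof.
move=> hp; rewrite -[RHS](card_Fp hp) -[RHS]expn1 -card_tuple -cardsT; apply: eq_card => b.
rewrite !inE; apply/asboolP/accessibleP => //; rewrite -(block_nth 0 b).
by pose x : 'F_p := b`_0; exists x, 1%N; apply/eq_block => -[|t] // _; rewrite bin1 natFp_val.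
Qed.

(** * Evaluation of the sum over types *)

Lemma big_Fp {V : nmodType} {p : nat} (F : nat -> V) : prime p ->
  \sum_(x : 'F_p) F x = \sum_(0 <= i < p) F i.
Proof. by move=> hp; rewrite -[in RHS](Fp_cast hp) big_mkord. Qed.

(** For a column residue [s], exactly [s] row residues satisfy [r < s] and lose a cell. *)
Lemma sum_threshold {p s : nat} (X Y : rat) : (s <= p)%N ->
  \sum_(0 <= r < p) (if (r < s)%N then X else Y) = s%:R * X + (p%:R - s%:R) * Y.
Proof.
move=> sp; rewrite (big_cat_nat (leq0n s) sp) //= -natrB // !mulr_natl; congr (_ + _).
  rewrite (eq_big_nat _ _ (F2 := fun=> X)) ?sumr_const_nat ?subn0 // => r /andP[_ ->] //.
rewrite (eq_big_nat _ _ (F2 := fun=> Y)) ?sumr_const_nat // => r /andP[sr _].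
by rewrite ltnNge sr.
Qed.

Lemma sum_affine (c X Y : rat) (N : nat) :
  \sum_(1 <= s < N.+1) (s%:R * X + (c - s%:R) * Y) =
  N%:R * (N%:R + 1) / 2%:R * X + (c * N%:R - N%:R * (N%:R + 1) / 2%:R) * Y.
Proof.
elim: N => [|N IHN]; first by rewrite big_geq //; field.
by rewrite big_nat_recr //= IHN -[N.+1]addn1 natrD; field.
Qed.

Theorem theorem2p3 (p : nat) (hp : prime p) (hp3 : (3 <= p)%N) :
  let a : nat -> nat := num_accessible (1 + 'X) p in
  [/\ a 0%N = 1%N,
      a 1%N = p,
      a 2%N = (p ^ 2)%N
    & forall n k : nat, (k <= p - 1)%N -> (3 <= p * n + k)%N ->
      (a (p * n + k)%N)%:R =
        (p%:R - k%:R) * (p%:R - k%:R + 1) / 2%:R * (a n)%:R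
        + (k%:R * p%:R + k%:R - k%:R ^+ 2 + (p%:R ^+ 2 - p%:R) / 2%:R)
          * (a n.+1)%:R
        + (k%:R ^+ 2 - k%:R) / 2%:R * (a n.+2)%:R
        - (2%:R * p%:R - 1) * (2%:R * p%:R - 2%:R) :> rat].
Proof.
move=> a; split; [exact: num_accessible0 | exact: num_accessible1 |
  exact: num_accessible2 |] => n k kp m3.
have p_gt0 := prime_gt0 hp; set m := (p * n + k)%N in m3 *.
(* [D s] counts the cells met before any is dropped; [T s] collects all row residues for column
   residue [s]. *)
pose D s := ((s + m + p.-1) %/ p)%N.
pose T s : rat := s%:R * (a (D s).-1)%:R + (p%:R - s%:R) * (a (D s))%:R.
have DE i j : (i < p)%N -> ((j * p + i) %/ p)%N = j.
  by move=> ip; rewrite divnMDl // divn_small ?addn0.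
have D1 s : (0 < s)%N -> (s <= p - k)%N -> D s = n.+1.
  move=> s0 sk; rewrite -(DE (s + k - 1)%N n.+1); last by lia.
  by rewrite /D /m; congr (_ %/ _)%N; lia.
have D2 s : (p - k < s)%N -> (s <= p)%N -> D s = n.+2.
  move=> s0 sk; rewrite -(DE (s + k - 1 - p)%N n.+2); last by lia.
  by rewrite /D /m; congr (_ %/ _)%N; lia.
have Dp : D p = (D 0%N).+1 by rewrite /D -addnA -{1}[p]mul1n divnMDl.
have types_sum : \sum_(0 <= s < p) T s =
    (a m + (p ^ 2).-1 + 3 * p.-1 ^ 2)%N%:R.
  rewrite -sum_num_cells // natr_sum -(pair_bigA _ (fun r s : 'F_p =>
    (num_accessible (1 + 'X) p (num_cells p m r s))%:R)) /= exchange_big /=.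
  rewrite -big_Fp //; apply: eq_bigr => s _; have sp := ltn_Fp s hp.
  rewrite /T -sum_threshold; last exact: ltnW.
  rewrite -big_Fp //; apply: eq_bigr => r _.
  by rewrite /num_cells -/(D s); case: ltnP; rewrite ?subn1 ?subn0.
(* Both [T 0] and [T p] equal [p] times the value at [D 0]. On the range from 1 to [p], [D] takes
   only the values [n.+1] and [n.+2], whereas [D 0] is [n] when [k = 0]. *)
have shift : \sum_(0 <= s < p) T s = \sum_(1 <= s < p.+1) T s.
  rewrite [LHS]big_ltn // [RHS]big_nat_recr //= addrC; congr (_ + _).
  by rewrite /T Dp /= subrr subr0 !mul0r addr0 add0r.
have split_sum : \sum_(1 <= s < p.+1) T s =
    (p - k)%:R * ((p - k)%:R + 1) / 2%:R * ((a n)%:R - (a n.+1)%:R)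
    + (p%:R * (p - k)%:R - (p - k)%:R * ((p - k)%:R + 1) / 2%:R)
      * ((a n.+1)%:R - (a n.+2)%:R)
    + p%:R * (p%:R + 1) / 2%:R * (a n.+1)%:R
    + (p%:R * p%:R - p%:R * (p%:R + 1) / 2%:R) * (a n.+2)%:R.
  have le1 : (1 <= (p - k).+1)%N by [].
  have le2 : ((p - k).+1 <= p.+1)%N by lia.
  (* The tail beyond [p - k] is obtained as the full affine sum minus its initial part. *)
  have := sum_affine p%:R (a n.+1)%:R (a n.+2)%:R p.
  rewrite (big_cat_nat le1 le2) //= sum_affine => e.
  rewrite (big_cat_nat le1 le2) //=.
  have -> : \sum_(1 <= s < (p - k).+1) T s =
      \sum_(1 <= s < (p - k).+1) (s%:R * (a n)%:R + (p%:R - s%:R) * (a n.+1)%:R).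
    by apply: eq_big_nat => s /andP[s0 sk]; rewrite /T D1.
  have -> : \sum_((p - k).+1 <= s < p.+1) T s =
      \sum_((p - k).+1 <= s < p.+1) (s%:R * (a n.+1)%:R + (p%:R - s%:R) * (a n.+2)%:R).
    by apply: eq_big_nat => s /andP[s0 sk]; rewrite /T D2.
  rewrite sum_affine; move/(canRL (addKr _)): e => ->.
  by field.
have total : (a m + (p ^ 2).-1 + 3 * p.-1 ^ 2)%N%:R =
    (a m)%:R + (p%:R ^+ 2 - 1 + 3%:R * (p%:R - 1) ^+ 2) :> rat.
  by rewrite -!subn1 -addnA natrD natrD natrB ?expn_gt0 ?p_gt0 // natrM !natrX natrB.
move: types_sum; rewrite shift split_sum total natrB; last by lia.
by move/esym/(canRL (addrK _)) ->; field.
Qed.
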